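(* Let $\mathcal{A}$ be a Hopf algebra with invertible antipode over a field, let $P\in\mathcal{A}$ be a right group-like projection, and let $\mathcal{V}_P$ be the smallest left coideal containing $P$ (it is contained in $\mathcal{N}_P$, $\mathcal{N}_P^l$ and $\mathcal{N}_P^r$). Then $\mathcal{V}_P$ is a right ideal in $\mathcal{N}^l_P$, a left ideal in $\mathcal{N}^r_P$, and a bilateral (two-sided) ideal in $\mathcal{N}_P$. Moreover $\mathcal{V}_P$ is idempotent as a (left, right or bilateral) ideal, i.e. $\mathcal{V}_P^2=\mathcal{V}_P$. In particular, for each of the three algebras $\mathcal{N}\in\{\mathcal{N}_P,\mathcal{N}^l_P,\mathcal{N}^r_P\}$ one has $\mathcal{V}_P=\mathcal{N}$ if and only if $1\in\mathcal{V}_P$. In that case also $\mathcal{N}^l_P=\mathcal{N}_P=\mathcal{N}^r_P$.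
   Context: $(\mathcal{A},\Delta,S,\varepsilon)$ is a Hopf algebra over an arbitrary field with invertible antipode $S$ and unit $1$. A projection is an idempotent. A right group-like projection is a non-zero projection $P\in\mathcal{A}$ with $\Delta(P)(1\otimes P)=P\otimes P=(1\otimes P)\Delta(P)$. A left coideal is a subspace $\mathcal{V}\subset\mathcal{A}$ with $\Delta(\mathcal{V})\subset\mathcal{A}\otimes\mathcal{V}$; a left coideal subalgebra is a unital subalgebra that is a left coideal. For a right group-like projection $P$ define the left coideal subalgebras $\mathcal{N}^l_P=\{x\in\mathcal{A}:(1\otimes P)\Delta(x)=x\otimes P\}$, $\mathcal{N}^r_P=\{x\in\mathcal{A}:\Delta(x)(1\otimes P)=x\otimes P\}$, $\mathcal{N}_P=\mathcal{N}^l_P\cap\mathcal{N}^r_P$, and the left coideal $\mathcal{V}_P=\{(\mu\otimes\mathrm{id})(\Delta(P)):\mu\in\mathcal{A}^*\}$. Here $\mathcal{V}_P^2$ is the linear span of products of two elements of $\mathcal{V}_P$. *)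

(* Defs.v *)
From HB Require Import structures.
From mathcomp Require Import all_boot all_order all_algebra.
From mathcomp Require Import generic_quotient boolp classical_sets.

Set Implicit Arguments.
Unset Strict Implicit.
Unset Printing Implicit Defensive.

Import GRing.Theory.
Local Open Scope classical_set_scope.
Local Open Scope ring_scope.
Local Open Scope quotient_scope.

(* The tensor product of two vector spaces, as the quotient of the free
   commutative monoid on V * W (finite formal sums of pairs, written as
   sequences) by the congruence generated by biadditivity and balancedness.
   Its universal property is given by the lemmas tens_liftE, tens_lift_linear
   and tens_linear_ext. *)

Section TensorProduct.
Variables (K : fieldType) (V W : lmodType K).

Inductive tens_eqv : seq (V * W) -> seq (V * W) -> Prop :=
| te_perm s t : perm_eq s t -> tens_eqv s t
| te_sym s t : tens_eqv s t -> tens_eqv t s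
| te_trans s t u : tens_eqv s t -> tens_eqv t u -> tens_eqv s u
| te_cat s t u : tens_eqv s t -> tens_eqv (s ++ u) (t ++ u)
| te_0 w : tens_eqv [:: (0, w)] [::]
| te_Dl v v' w : tens_eqv [:: (v + v', w)] [:: (v, w); (v', w)]
| te_Dr v w w' : tens_eqv [:: (v, w + w')] [:: (v, w); (v, w')]
| te_Z a v w : tens_eqv [:: (a *: v, w)] [:: (v, a *: w)].

Definition tens_eqvb (s t : seq (V * W)) : bool := `[< tens_eqv s t >].

Lemma tens_eqvb_refl : reflexive tens_eqvb.
Proof. by move=> s; apply/asboolP/te_perm. Qed.
Lemma tens_eqvb_sym : symmetric tens_eqvb.
Proof. by move=> s t; apply/asboolP/asboolP => /te_sym. Qed.
Lemma tens_eqvb_trans : transitive tens_eqvb.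
Proof.
by move=> t s u /asboolP st /asboolP tu; apply/asboolP/(te_trans st tu).
Qed.

Canonical tens_equiv :=
  EquivRel tens_eqvb tens_eqvb_refl tens_eqvb_sym tens_eqvb_trans.

Definition tensor := {eq_quot tens_equiv}.

HB.instance Definition _ := Choice.on tensor.
HB.instance Definition _ := EqQuotient.on tensor.

Lemma tens_piP (s t : seq (V * W)) :
  \pi_tensor s = \pi_tensor t <-> tens_eqv s t.
Proof.
split; first by move=> /eqP; rewrite eqmodE => /asboolP.
by move=> st; apply/eqP; rewrite eqmodE; apply/asboolP.
Qed.

Definition tens (v : V) (w : W) : tensor := \pi_tensor [:: (v, w)].

Definition tens_zero : tensor := \pi_tensor [::].
Definition tens_add (x y : tensor) : tensor := \pi_tensor (repr x ++ repr y).
Definition tens_scale (a : K) (x : tensor) : tensor :=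
  \pi_tensor [seq (a *: p.1, p.2) | p <- repr x].

Lemma tens_eqv_cat s s' t t' :
  tens_eqv s s' -> tens_eqv t t' -> tens_eqv (s ++ t) (s' ++ t').
Proof.
move=> ss tt; apply: (te_trans (te_cat t ss)).
have swap u v : tens_eqv (u ++ v) (v ++ u) by apply: te_perm; rewrite perm_catC.
exact: te_trans (swap _ _) (te_trans (te_cat _ tt) (swap _ _)).
Qed.

Lemma tens_pi_cat s t :
  \pi_tensor (s ++ t) = tens_add (\pi_tensor s) (\pi_tensor t).
Proof.
by apply/tens_piP/tens_eqv_cat; apply/tens_piP; rewrite reprK.
Qed.

Lemma tens_pi_scale a s :
  \pi_tensor [seq (a *: p.1, p.2) | p <- s] = tens_scale a (\pi_tensor s).
Proof.
apply/tens_piP; have: tens_eqv s (repr (\pi_tensor s)).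
  by apply/tens_piP; rewrite reprK.
elim=> {s}[s t st|s t _|s t u _ IH1 _|s t u _ IH|w|v v' w|v w w'|b v w] /=.
- exact/te_perm/perm_map.
- exact: te_sym.
- exact: te_trans IH1.
- by rewrite !map_cat; apply: te_cat.
- by rewrite scaler0; apply: te_0.
- by rewrite scalerDr; apply: te_Dl.
- exact: te_Dr.
- by rewrite scalerA mulrC -scalerA; apply: te_Z.
Qed.

Lemma tens_addA : associative tens_add.
Proof.
move=> x y z; rewrite -[x]reprK -[y]reprK -[z]reprK.
move: (repr x) (repr y) (repr z) => s t u.
by rewrite -(tens_pi_cat t u) -(tens_pi_cat s t) -2!tens_pi_cat catA.
Qed.
Lemma tens_addC : commutative tens_add.
Proof.
by move=> x y; apply/tens_piP/te_perm; rewrite perm_catC.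
Qed.
Lemma tens_add0 : left_id tens_zero tens_add.
Proof. by move=> x; rewrite -[x]reprK -tens_pi_cat. Qed.

HB.instance Definition _ :=
  GRing.isNmodule.Build tensor tens_addA tens_addC tens_add0.

Lemma tens_pi_sum s : \pi_tensor s = \sum_(p <- s) tens p.1 p.2.
Proof.
elim: s => [|[v w] s IH]; first by rewrite big_nil.
by rewrite big_cons -IH -cat1s tens_pi_cat.
Qed.

Lemma tensP (x : tensor) : exists s : seq (V * W),
  x = \sum_(p <- s) tens p.1 p.2.
Proof. by exists (repr x); rewrite -tens_pi_sum reprK. Qed.

Lemma tens_ind (Q : tensor -> Prop) : Q 0 ->
  (forall v w x, Q x -> Q (tens v w + x)) -> forall x, Q x.
Proof.
move=> Q0 QD x; have [s ->] := tensP x.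
by elim: s => [|p s IH]; rewrite ?big_nil ?big_cons //; apply: QD.
Qed.

Lemma tens_scale_tens a v w : tens_scale a (tens v w) = tens (a *: v) w.
Proof. by rewrite -tens_pi_scale. Qed.
Lemma tens_scaleD a : {morph tens_scale a : x y / x + y}.
Proof.
move=> x y; rewrite -[x]reprK -[y]reprK -[_ + _]tens_pi_cat -!tens_pi_scale.
by rewrite map_cat tens_pi_cat.
Qed.
Lemma tens_scale0 a : tens_scale a 0 = 0.
Proof. by rewrite -[0 in LHS]/(\pi_tensor [::]) -tens_pi_scale. Qed.
Lemma tensDl_subproof v v' w : tens (v + v') w = tens v w + tens v' w.
Proof. by rewrite -[RHS]tens_pi_cat; apply/tens_piP/te_Dl. Qed.
Lemma tens0l w : tens 0 w = 0.
Proof. by apply/tens_piP/te_0. Qed.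

Lemma tens_scalerA a b x : tens_scale a (tens_scale b x) = tens_scale (a * b) x.
Proof.
elim/tens_ind: x => [|v w x IH]; first by rewrite !tens_scale0.
by rewrite !tens_scaleD IH !tens_scale_tens scalerA.
Qed.
Lemma tens_scale0r x : tens_scale 0 x = 0.
Proof.
elim/tens_ind: x => [|v w x IH]; first by rewrite !tens_scale0.
by rewrite tens_scaleD IH tens_scale_tens scale0r tens0l addr0.
Qed.
Lemma tens_scale1r : left_id 1 tens_scale.
Proof.
move=> x; elim/tens_ind: x => [|v w x IH]; first by rewrite !tens_scale0.
by rewrite tens_scaleD IH tens_scale_tens scale1r.
Qed.
Lemma tens_scalerDl x : {morph tens_scale^~ x : a b / a + b}.
Proof.
move=> a b; elim/tens_ind: x => [|v w x IH].
  by rewrite !tens_scale0 addr0.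
by rewrite !tens_scaleD IH !tens_scale_tens scalerDl tensDl_subproof addrACA.
Qed.

HB.instance Definition _ := GRing.Nmodule_isLSemiModule.Build K tensor
  tens_scalerA tens_scale0r tens_scale1r tens_scaleD tens_scalerDl.
HB.instance Definition _ := GRing.LSemiModule_isLmodule.Build K tensor.

Lemma tensZl a v w : tens (a *: v) w = a *: tens v w.
Proof. by rewrite -[RHS]/(tens_scale _ _) tens_scale_tens. Qed.
Lemma tensZr a v w : tens v (a *: w) = a *: tens v w.
Proof. by rewrite -tensZl; apply/esym/tens_piP/te_Z. Qed.
Lemma tensDl v v' w : tens (v + v') w = tens v w + tens v' w.
Proof. exact: tensDl_subproof. Qed.
Lemma tensDr v w w' : tens v (w + w') = tens v w + tens v w'.
Proof. by rewrite -[RHS]tens_pi_cat; apply/tens_piP/te_Dr. Qed.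

Lemma tens_bilinear : bilinear_for *:%R *:%R tens.
Proof.
by split=> [w a v v'|v a w w']; rewrite ?tensDl ?tensDr ?tensZl ?tensZr.
Qed.

End TensorProduct.

Arguments tens {K V W}.
Notation "v ⊗ w" := (tens v w) (at level 40, left associativity) : ring_scope.

(* The map on V ⊗ W induced by f, meaningful when f is bilinear. *)
Definition tens_lift (K : fieldType) (V W U : lmodType K) (f : V -> W -> U)
  (x : tensor V W) : U := \sum_(p <- repr x) f p.1 p.2.

Section Lift.
Variables (K : fieldType) (V W U : lmodType K) (f : V -> W -> U).
Hypothesis bf : bilinear_for *:%R *:%R f.

Let fDl v v' w : f (v + v') w = f v w + f v' w.
Proof. by have := bf.1 w 1 v v'; rewrite /= !scale1r. Qed.
Let fDr v w w' : f v (w + w') = f v w + f v w'.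
Proof. by have := bf.2 v 1 w w'; rewrite /= !scale1r. Qed.
Let f0l w : f 0 w = 0.
Proof. by apply: (addrI (f 0 w)); rewrite -fDl !addr0. Qed.
Let f0r v : f v 0 = 0.
Proof. by apply: (addrI (f v 0)); rewrite -fDr !addr0. Qed.
Let fZl a v w : f (a *: v) w = a *: f v w.
Proof. by have := bf.1 w a v 0; rewrite /= !addr0 f0l addr0. Qed.
Let fZr a v w : f v (a *: w) = a *: f v w.
Proof. by have := bf.2 v a w 0; rewrite /= !addr0 f0r addr0. Qed.

Lemma tens_lift_pi s :
  tens_lift f (\pi_(tensor V W) s) = \sum_(p <- s) f p.1 p.2.
Proof.
apply/esym; rewrite /tens_lift.
have: tens_eqv s (repr (\pi_(tensor V W) s)) by apply/tens_piP; rewrite reprK.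
elim=> {s}[s t st|s t _|s t u _ IH1 _|s t u _ IH|w|v v' w|v w w'|b v w] //.
- exact: perm_big.
- by rewrite IH1.
- by rewrite !big_cat IH.
- by rewrite big_seq1 big_nil f0l.
- by rewrite big_seq1 big_cons big_seq1 fDl.
- by rewrite big_seq1 big_cons big_seq1 fDr.
- by rewrite !big_seq1 /= fZl fZr.
Qed.

Lemma tens_liftE v w : tens_lift f (v ⊗ w) = f v w.
Proof. by rewrite tens_lift_pi big_seq1. Qed.

Lemma tens_lift_linear : linear (tens_lift f).
Proof.
have D x y : tens_lift f (x + y) = tens_lift f x + tens_lift f y.
  by rewrite -[x]reprK -[y]reprK -[_ + _]tens_pi_cat !tens_lift_pi big_cat.
have Z0 : tens_lift f 0 = 0.
  by rewrite -[0 in LHS]/(\pi_(tensor V W) [::]) tens_lift_pi big_nil.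
move=> a x y; rewrite D; congr (_ + _).
elim/tens_ind: x => [|v w x IH]; first by rewrite scaler0 Z0 scaler0.
by rewrite scalerDr !D scalerDr IH -tensZl !tens_liftE fZl.
Qed.

End Lift.

Lemma tens_lift_linear_param (K : fieldType) (V W U U' : lmodType K)
    (h : U' -> V -> W -> U) : (forall v w, linear (fun u => h u v w)) ->
  forall x, linear (fun u => tens_lift (h u) x).
Proof.
move=> lh x a u u'; rewrite /tens_lift scaler_sumr -big_split.
by apply: eq_bigr => p _; rewrite lh.
Qed.

Lemma tens_linear_ext (K : fieldType) (V W U : lmodType K)
    (f g : tensor V W -> U) : linear f -> linear g ->
  (forall v w, f (v ⊗ w) = g (v ⊗ w)) -> f =1 g.
Proof.
move=> lf lg fg x.
have D h : linear h -> forall x y : tensor V W, h (x + y) = h x + h y :> U.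
  by move=> lh y z; have := lh 1 y z; rewrite !scale1r.
have Z0 h : linear h -> h (0 : tensor V W) = 0 :> U.
  by move=> lh; apply: (addrI (h 0)); rewrite -D // !addr0.
elim/tens_ind: x => [|v w x IH]; first by rewrite !Z0.
by rewrite !D // fg IH.
Qed.

Definition tens_map (K : fieldType) (V V' W W' : lmodType K)
    (f : V -> V') (g : W -> W') : tensor V W -> tensor V' W' :=
  tens_lift (fun v w => f v ⊗ g w).

Definition tens_assoc (K : fieldType) (U V W : lmodType K) :
    tensor (tensor U V) W -> tensor U (tensor V W) :=
  tens_lift (fun x w => tens_lift (fun u v => u ⊗ (v ⊗ w)) x).

Lemma tens_map_bilinear (K : fieldType) (V V' W W' : lmodType K)
    (f : {linear V -> V'}) (g : {linear W -> W'}) :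
  bilinear_for *:%R *:%R (fun v w => f v ⊗ g w).
Proof.
by split=> [w a v v'|v a w w'] /=;
  rewrite linearP ?tensDl ?tensDr ?tensZl ?tensZr.
Qed.

Lemma tens_mapE (K : fieldType) (V V' W W' : lmodType K)
    (f : {linear V -> V'}) (g : {linear W -> W'}) v w :
  tens_map f g (v ⊗ w) = f v ⊗ g w.
Proof. exact/tens_liftE/tens_map_bilinear. Qed.

Lemma tens_assocE (K : fieldType) (U V W : lmodType K) (u : U) (v : V) (w : W) :
  tens_assoc ((u ⊗ v) ⊗ w) = u ⊗ (v ⊗ w).
Proof.
have b w' : bilinear_for *:%R *:%R (fun (u : U) (v : V) => u ⊗ (v ⊗ (w' : W))).
  by split=> [y a x x'|x a y y'] /=; rewrite ?(tensDl, tensDr, tensZl, tensZr).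
rewrite /tens_assoc tens_liftE ?tens_liftE //; split=> [y|x].
  exact: tens_lift_linear.
by apply: tens_lift_linear_param => u' v' a y y';
  rewrite ?(tensDl, tensDr, tensZl, tensZr).
Qed.

Section TensorAlgebra.
Variables (K : fieldType) (A B : algType K).

(* Only a pzRingType structure is put on A ⊗ B (rather than an algType, which
   would need 1 ⊗ 1 != 0); its scalar multiplication is the vector space one,
   compatible with the product by tens_scalerAl and tens_scalerAr. *)

Definition tens_mul (x y : tensor A B) : tensor A B :=
  tens_lift (fun a b => tens_lift (fun c d => (a * c) ⊗ (b * d)) y) x.

Let b2 a b :
  bilinear_for *:%R *:%R (fun (c : A) (d : B) => (a * c) ⊗ (b * d)).
Proof.
by split=> [d k c c'|c k d d'] /=;
  rewrite mulrDr -scalerAr ?(tensDl, tensDr, tensZl, tensZr).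
Qed.
Let b1 y : bilinear_for *:%R *:%R (fun (a : A) (b : B) =>
   tens_lift (fun c d => (a * c) ⊗ (b * d)) y).
Proof.
split=> [b|a].
  apply: (tens_lift_linear_param (h := fun a c d => (a * c) ⊗ (b * d))).
  by move=> c d k a a'; rewrite mulrDl -scalerAl ?(tensDl, tensZl).
apply: (tens_lift_linear_param (h := fun b c d => (a * c) ⊗ (b * d))).
by move=> c d k b b'; rewrite mulrDl -scalerAl ?(tensDr, tensZr).
Qed.

Lemma tens_mulE a b c d : tens_mul (a ⊗ b) (c ⊗ d) = (a * c) ⊗ (b * d).
Proof. by rewrite /tens_mul tens_liftE // tens_liftE. Qed.

Lemma tens_mul_linearl y : linear (tens_mul^~ y).
Proof. exact: tens_lift_linear. Qed.
Lemma tens_mul_linearr x : linear (tens_mul x).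
Proof.
by apply: tens_lift_linear_param => a b; apply: tens_lift_linear.
Qed.

Lemma tens_mulDl : left_distributive tens_mul +%R.
Proof. by move=> x y z; have := tens_mul_linearl z 1 x y; rewrite !scale1r. Qed.
Lemma tens_mulDr : right_distributive tens_mul +%R.
Proof. by move=> x y z; have := tens_mul_linearr x 1 y z; rewrite !scale1r. Qed.
Lemma tens_mul0l x : tens_mul 0 x = 0.
Proof. by apply: (addrI (tens_mul 0 x)); rewrite -tens_mulDl !addr0. Qed.
Lemma tens_mul0r x : tens_mul x 0 = 0.
Proof. by apply: (addrI (tens_mul x 0)); rewrite -tens_mulDr !addr0. Qed.

Lemma tens_mulA : associative tens_mul.
Proof.
move=> x y z; elim/tens_ind: x => [|a b x IHx].
  by rewrite !tens_mul0l.
rewrite !tens_mulDl IHx; congr (_ + _); clear x IHx.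
elim/tens_ind: y => [|c d y IHy]; first by rewrite tens_mul0l !tens_mul0r tens_mul0l.
rewrite tens_mulDr !tens_mulDl tens_mulDr IHy; congr (_ + _); clear y IHy.
elim/tens_ind: z => [|e f z IHz]; first by rewrite !tens_mul0r.
by rewrite !tens_mulDr IHz !tens_mulE !mulrA.
Qed.
Lemma tens_mul1l : left_id (1 ⊗ 1) tens_mul.
Proof.
move=> x; elim/tens_ind: x => [|a b x IHx]; first by rewrite tens_mul0r.
by rewrite tens_mulDr IHx tens_mulE !mul1r.
Qed.
Lemma tens_mul1r : right_id (1 ⊗ 1) tens_mul.
Proof.
move=> x; elim/tens_ind: x => [|a b x IHx]; first by rewrite tens_mul0l.
by rewrite tens_mulDl IHx tens_mulE !mulr1.
Qed.

HB.instance Definition _ := GRing.Zmodule_isPzRing.Build (tensor A B)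
  tens_mulA tens_mul1l tens_mul1r tens_mulDl tens_mulDr.

Lemma tensM (a c : A) (b d : B) : (a ⊗ b) * (c ⊗ d) = (a * c) ⊗ (b * d).
Proof. exact: tens_mulE. Qed.

Lemma tens_scalerAl (a : K) (x y : tensor A B) : a *: (x * y) = (a *: x) * y.
Proof.
have /= := tens_mul_linearl y a x 0.
by rewrite addr0 [tens_mul 0 y]tens_mul0l addr0.
Qed.
Lemma tens_scalerAr (a : K) (x y : tensor A B) : a *: (x * y) = x * (a *: y).
Proof.
have /= := tens_mul_linearr x a y 0.
by rewrite addr0 [tens_mul x 0]tens_mul0r addr0.
Qed.

End TensorAlgebra.

HB.mixin Record Algebra_isHopf (K : fieldType) A of GRing.Algebra K A := {
  comul : {lrmorphism A -> tensor A A};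
  counit : {lrmorphism A -> K | *%R};
  antipode : {linear A -> A};
  comulA : forall x : A,
    tens_assoc (tens_map comul idfun (comul x)) =
    tens_map idfun comul (comul x);
  comul_counitl : forall x : A,
    tens_lift (fun a b : A => counit a *: b) (comul x) = x;
  comul_counitr : forall x : A,
    tens_lift (fun a b : A => counit b *: a) (comul x) = x;
  antipodel : forall x : A,
    tens_lift (fun a b : A => antipode a * b) (comul x) = (counit x)%:A;
  antipoder : forall x : A,
    tens_lift (fun a b : A => a * antipode b) (comul x) = (counit x)%:A
}.

#[short(type="hopfAlgType")]
HB.structure Definition HopfAlgebra (K : fieldType) :=
  {A of GRing.Algebra K A & Algebra_isHopf K A}.

Section Subspaces.
Variables (K : fieldType) (A : algType K).
Implicit Types V W N : set A.

Definition is_subspace V :=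
  V 0 /\ forall (a : K) x y, V x -> V y -> V (a *: x + y).

(* The linear span of the products of an element of V and one of W. *)
Definition prod_span V W : set A :=
  [set x | exists2 s : seq (A * A),
     forall p, p \in s -> V p.1 /\ W p.2 & x = \sum_(p <- s) p.1 * p.2].

(* The image of A ⊗ V in A ⊗ A. *)
Definition tens_right V : set (tensor A A) :=
  [set t | exists2 s : seq (A * A),
     forall p, p \in s -> V p.2 & t = \sum_(p <- s) p.1 ⊗ p.2].

Definition is_unital_subalgebra N :=
  [/\ is_subspace N, N 1 & forall x y, N x -> N y -> N (x * y)].

Definition is_right_ideal N V :=
  [/\ is_subspace V, V `<=` N & forall x n, V x -> N n -> V (x * n)].

Definition is_left_ideal N V :=
  [/\ is_subspace V, V `<=` N & forall n x, N n -> V x -> V (n * x)].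

Definition is_ideal N V := is_left_ideal N V /\ is_right_ideal N V.

End Subspaces.

Section GroupLike.
Variables (K : fieldType) (A : hopfAlgType K).
Implicit Types (P : A) (V W : set A).

Definition is_left_coideal V :=
  is_subspace V /\ forall x, V x -> tens_right V (comul x).

Definition right_group_like_projection P :=
  [/\ P != 0, P * P = P, comul P * (1 ⊗ P) = P ⊗ P
    & P ⊗ P = (1 ⊗ P) * comul P].

Definition Nl P : set A := [set x | (1 ⊗ P) * comul x = x ⊗ P].
Definition Nr P : set A := [set x | comul x * (1 ⊗ P) = x ⊗ P].
Definition Nlr P : set A := Nl P `&` Nr P.

(* mu ⊗ id, with K ⊗ A identified with A. *)
Definition slice (mu : {scalar A}) : tensor A A -> A :=
  tens_lift (fun a b => mu a *: b).

Definition coideal_of P : set A :=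
  [set x | exists mu : {scalar A}, x = slice mu (comul P)].

Definition is_smallest_left_coideal P V :=
  [/\ is_left_coideal V, V P
    & forall W, is_left_coideal W -> W P -> V `<=` W].

Lemma Nl_unital_subalgebra P : is_unital_subalgebra (Nl P).
Proof.
rewrite /Nl; split=> [||x y /= Nx Ny]; first split=> [|a x y /= Nx Ny] /=.
- by rewrite raddf0 mulr0 tens0l.
- by rewrite linearP mulrDr -tens_scalerAr Nx Ny tensDl tensZl.
- by rewrite /= rmorph1 mulr1.
have xP : x ⊗ P = (x ⊗ 1) * (1 ⊗ P) by rewrite tensM mulr1 mul1r.
by rewrite rmorphM mulrA Nx xP -mulrA Ny tensM mul1r.
Qed.

Lemma Nr_unital_subalgebra P : is_unital_subalgebra (Nr P).
Proof.
rewrite /Nr; split=> [||x y /= Nx Ny]; first split=> [|a x y /= Nx Ny] /=.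
- by rewrite raddf0 mul0r tens0l.
- by rewrite linearP mulrDl -tens_scalerAl Nx Ny tensDl tensZl.
- by rewrite /= rmorph1 mul1r.
have yP : y ⊗ P = (1 ⊗ P) * (y ⊗ 1) by rewrite tensM mulr1 mul1r.
by rewrite rmorphM -mulrA Ny yP mulrA Nx tensM mulr1.
Qed.

Lemma Nlr_unital_subalgebra P : is_unital_subalgebra (Nlr P).
Proof.
have [[l0 lP] l1 lM] := Nl_unital_subalgebra P.
have [[r0 rP] r1 rM] := Nr_unital_subalgebra P.
split=> [||x y [? ?] [? ?]]; [split=> // a x y [? ?] [? ?]| by []|];
  by split; [apply: lP + apply: lM | apply: rP + apply: rM].
Qed.

End GroupLike.

(* Main.v *)
Require Import Defs.
From HB Require Import structures.
From mathcomp Require Import all_boot all_order all_algebra.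
From mathcomp Require Import boolp classical_sets.

Set Implicit Arguments.
Unset Strict Implicit.
Unset Printing Implicit Defensive.

Import GRing.Theory.
Local Open Scope classical_set_scope.
Local Open Scope ring_scope.

(** Write P1 ⊗ P2 for Δ(P), V for the left coideal spanned by the slices of
Δ(P), and N^l, N^r for the two coideal subalgebras attached to P.

Everything rests on Δ(P) lying in A ⊗ V. A tensor is always a sum of elementary
tensors a_i ⊗ b_i in which the b_i are slices: when the a_i are linearly
independent, a functional equal to 1 on a_j and to 0 on the other a_i recovers
b_j ([slice_decomposition]). In infinite dimension such a functional comes from
a maximal subspace avoiding a_j, hence from Zorn's lemma
([separating_functional]). Given this, coassociativity makes V a left coideal,
and it is clearly contained in any other left coideal through P. Moreover
Δ(P) = Δ(P)Δ(P) exhibits each slice of Δ(P) as a sum of products of two elements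
of V, so V is contained in V^2 ([coideal_of_idem]).

The ideal properties come from moving a factor from one leg of Δ(P) to the other.
For x in N^r one has x1 ⊗ x2 P = x ⊗ P, so that
  S(x) P1 ⊗ P2 = S(x1) x2 P1 ⊗ x3 P2 = P1 ⊗ x P2            ([Nr_twist]),
which says that left multiplication by x turns the slice of Δ(P) along mu into the
slice along mu(S(x) -). For x in N^l the same computation on the other side would
use S^-1(x). It is carried out after applying S to the first leg, which replaces
antimultiplicativity of the antipode by the identity
x1 S(p x2) = ε(x) S(p) ([antipode_twist]):
  x S(P1) ⊗ P2 = x1 S(P1 x2) ⊗ P2 x3 = S(P1) ⊗ P2 x          ([Nl_twist]).
A functional mu is then written as (mu o S^-1) o S, and this is where
bijectivity of the antipode enters.

Since V is contained in N^l and in N^r, the inclusion of V^2 in V follows; and an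
ideal on either side is the whole algebra exactly when it contains 1. *)

(* Sums over the Sweedler components of a coproduct: a ⊗ b runs through Δ(x). *)
Local Notation "\sw_ ( a , b <- x ) E" := (tens_lift (fun a b => E) (comul x))
  (at level 41, E at level 41, x at level 50, a name, b name) : ring_scope.

(** * Linear maps out of tensor products *)

Lemma linear_fun0 (K : fieldType) (U V : lmodType K) (h : U -> V) :
  linear h -> h 0 = 0.
Proof.
by move=> lh; rewrite -[0 in LHS](addNr 0) -scaleN1r lh scaleN1r addNr.
Qed.

Lemma linear_funZ (K : fieldType) (U V : lmodType K) (h : U -> V) k u :
  linear h -> h (k *: u) = k *: h u.
Proof. by move=> lh; have := lh k u 0; rewrite (linear_fun0 lh) !addr0. Qed.

Section LiftSums.
Variables (K : fieldType) (V W U : lmodType K).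
Implicit Types (f g : V -> W -> U) (t : tensor V W).

Lemma eq_tens_lift f g t : f =2 g -> tens_lift f t = tens_lift g t.
Proof. by move=> fg; apply: eq_bigr => p _; rewrite fg. Qed.

Lemma tens_lift_tens t : tens_lift (@tens K V W) t = t.
Proof. by rewrite /tens_lift -tens_pi_sum reprK. Qed.

Lemma tens_lift_sum f s : bilinear_for *:%R *:%R f ->
  tens_lift f (\sum_(p <- s) p.1 ⊗ p.2) = \sum_(p <- s) f p.1 p.2.
Proof. by move=> bf; rewrite -tens_pi_sum tens_lift_pi. Qed.

Lemma linear_tens_lift (U' : lmodType K) (h : U -> U') f t : linear h ->
  h (tens_lift f t) = tens_lift (fun a b => h (f a b)) t.
Proof.
move=> lh; have hD x y : h (x + y) = h x + h y.
  by have := lh 1 x y; rewrite !scale1r.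
exact: (big_morph h hD (linear_fun0 lh)).
Qed.

Lemma exchange_tens_lift (V' W' : lmodType K) (f : V -> W -> V' -> W' -> U)
    t (t' : tensor V' W') :
  tens_lift (fun a b => tens_lift (f a b) t') t =
  tens_lift (fun c d => tens_lift (fun a b => f a b c d) t) t'.
Proof. exact: exchange_big. Qed.

End LiftSums.

(** * Functionals separating a vector from a subspace *)

Section SeparatingFunctionals.
Variables (K : fieldType) (V : lmodType K).

Definition lin_closed (M : set V) :=
  M 0 /\ forall (a : K) x y, M x -> M y -> M (a *: x + y).

(** A subspace maximal among those that contain M and avoid v is a hyperplane
complementary to the line through v: adjoining to it a vector outside it produces
v, so that vector is a multiple of v modulo the subspace. *)
Lemma maximal_avoiding_subspace (M : set V) v : lin_closed M -> ~ M v ->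
  exists H : set V, [/\ lin_closed H, M `<=` H, ~ H v &
    forall w, exists c : K, H (w - c *: v)].
Proof.
move=> [M0 MP] Mv.
(* M is put in the union so that the empty chain needs no separate treatment. *)
pose Q X := (forall a x y, (M `|` X) x -> (M `|` X) y -> (M `|` X) (a *: x + y))
  /\ ~ (M `|` X) v.
have [|X [[XP Xv] Xmax]] := @Zorn_bigcup V Q.
  move=> F FQ Ftot; split=> [a x y|[//|[X /FQ[_ +]]]]; last first.
    by move=> + Xv; apply; right.
  case=> [Mx|[X FX Xx]] [My|[Y FY Yy]]; first by left; apply: MP.
  - have [+ _] := FQ _ FY => /(_ a x y (or_introl Mx) (or_intror Yy)).
    by case=> ?; [left|right; exists Y].
  - have [+ _] := FQ _ FX => /(_ a x y (or_intror Xx) (or_introl My)).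
    by case=> ?; [left|right; exists X].
  - have [XY|YX] := Ftot _ _ FX FY.
      have [+ _] := FQ _ FY => /(_ a x y (or_intror (XY _ Xx)) (or_intror Yy)).
      by case=> ?; [left|right; exists Y].
    have [+ _] := FQ _ FX => /(_ a x y (or_intror Xx) (or_intror (YX _ Yy))).
    by case=> ?; [left|right; exists X].
exists (M `|` X); split=> // [|w]; first by split=> //; left.
have HN x : (M `|` X) x -> (M `|` X) (- x).
  by move=> Hx; rewrite -scaleN1r -[_ *: _]addr0; apply: XP => //; left.
have HZ (c : K) x : (M `|` X) x -> (M `|` X) (c *: x).
  by move=> Hx; rewrite -[_ *: _]addr0; apply: XP => //; left.
have [Hw|Hw] := pselect ((M `|` X) w); first by exists 0; rewrite scale0r subr0.
pose Y := [set z | exists2 h, (M `|` X) h & exists c : K, z = h + c *: w].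
have HY : M `|` X `<=` Y.
  by move=> h Hh; exists h => //; exists 0; rewrite scale0r addr0.
have MY : M `|` Y = Y by apply/setUidPr => z Mz; apply: HY; left.
have XY : X `<` Y.
  split=> [z Xz|]; first by apply: HY; right.
  move=> /(_ w) YX; apply: Hw; right; apply: YX.
  by exists 0; [left|exists 1; rewrite scale1r add0r].
have Yv : Y v.
  apply: contrapT => nYv; apply: (Xmax _ XY); split; rewrite MY // => a.
  move=> _ _ [h Hh [c ->]] [h' Hh' [c' ->]].
  exists (a *: h + h'); first exact: XP.
  by exists (a * c + c'); rewrite scalerDr scalerDl scalerA addrACA.
have [h Hh [c vE]] := Yv.
have c0 : c != 0.
  by apply: contra_notN Xv => /eqP c0; rewrite vE c0 scale0r addr0.
exists c^-1; rewrite vE scalerDr scalerA mulVf // scale1r opprD addrCA subrr addr0.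
exact/HN/HZ.
Qed.

(** The functional is the coordinate along v modulo a hyperplane containing M
and avoiding v. *)
Lemma separating_functional (M : set V) v : lin_closed M -> ~ M v ->
  exists2 mu : {scalar V}, mu v = 1 & forall x, M x -> mu x = 0.
Proof.
move=> Ml Mv.
have [H [[H0 HP] MH Hv Hdec]] := maximal_avoiding_subspace Ml Mv.
have [f fE] := choice Hdec.
have HZ (c : K) x : H x -> H (c *: x).
  by move=> Hx; rewrite -[_ *: _]addr0; apply: HP.
(* f is obtained by choice: its linearity rests on uniqueness of the coordinate. *)
have funiq w c : H (w - c *: v) -> f w = c.
  move=> Hc; apply/eqP; rewrite -subr_eq0; apply: contra_notT Hv => d0.
  rewrite -[v]scale1r -(mulVf d0) -scalerA; apply: HZ.
  suff -> : (f w - c) *: v = (-1) *: (w - f w *: v) + (w - c *: v) by apply: HP.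
  by rewrite scaleN1r opprB -addrA addKr scalerBl.
have lf : GRing.linear_for *%R f.
  move=> a x y; apply: funiq.
  suff -> : a *: x + y - (a * f x + f y) *: v
      = a *: (x - f x *: v) + (y - f y *: v) by apply: HP.
  by rewrite scalerDl scalerBr scalerA opprD addrACA.
pose lfm := GRing.isLinear.Build K V K *%R f lf.
pose mu : {scalar V} := HB.pack f lfm.
exists mu => [|x Mx]; apply: funiq; first by rewrite scale1r subrr.
by rewrite scale0r subr0; apply: MH.
Qed.

End SeparatingFunctionals.
(** * Tensors as sums over their own slices *)

Section SliceDecomposition.
Variables (K : fieldType) (V W : lmodType K).

Lemma slice_bilinear (mu : {scalar V}) :
  bilinear_for *:%R *:%R (fun (a : V) (b : W) => mu a *: b).
Proof.
by split=> [b k a a'|a k b b'] /=;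
  rewrite ?linearP ?scalerDl ?scalerDr ?scalerA // mulrC.
Qed.

(** Induction on the number of terms. If some a_j is a combination of the others,
its term is absorbed into the remaining ones; otherwise each a_j is separated from
the others by a functional, along which the slice of t is b_j. *)
Lemma slice_decomposition (t : tensor V W) : exists2 s : seq (V * W),
  forall p, p \in s ->
    exists mu : {scalar V}, p.2 = tens_lift (fun a b => mu a *: b) t
  & t = \sum_(p <- s) p.1 ⊗ p.2.
Proof.
suff ordE n (a : 'I_n -> V) (b : 'I_n -> W) : t = \sum_i a i ⊗ b i ->
    exists2 s : seq (V * W), forall p, p \in s ->
      exists mu : {scalar V}, p.2 = tens_lift (fun a b => mu a *: b) t
    & t = \sum_(p <- s) p.1 ⊗ p.2.
  have [s sE] := tensP t.
  apply: (ordE _ (fun i => (tnth (in_tuple s) i).1)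
                 (fun i => (tnth (in_tuple s) i).2)).
  by rewrite sE big_tnth.
elim: n a b => [|n IHn] a b tE.
  by exists [::] => //; rewrite tE big_ord0 big_nil.
pose M (j : 'I_n.+1) := [set x | exists c : 'I_n -> K, x = \sum_i c i *: a (lift j i)].
have [[j [c aj]]|indep] := pselect (exists j, M j (a j)).
  apply: (IHn (fun i => a (lift j i)) (fun i => b (lift j i) + c i *: b j)).
  rewrite tE (bigD1_ord j) //= aj [in LHS](big_morph (tens^~ (b j))
    (fun x y => tensDl x y (b j)) (tens0l _ _)) -big_split.
  by apply: eq_bigr => i _ /=; rewrite tensDr tensZl tensZr addrC.
have Ml j : lin_closed (M j).
  split=> [|k _ _ [c ->] [c' ->]].
    by exists (fun=> 0); rewrite big1 // => i _; rewrite scale0r.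
  exists (fun i => k * c i + c' i); rewrite scaler_sumr -big_split.
  by apply: eq_bigr => i _; rewrite scalerDl scalerA.
exists [seq (a i, b i) | i <- enum 'I_n.+1]; last by rewrite big_map big_enum.
move=> _ /mapP[j _ ->] /=.
have [mu mu1 mu0] :=
  separating_functional (Ml j) (fun Mj => indep (ex_intro _ j Mj)).
exists mu; rewrite tE.
have -> : \sum_i a i ⊗ b i = \sum_(p <- [seq (a i, b i) | i <- enum 'I_n.+1])
    p.1 ⊗ p.2 by rewrite big_map big_enum.
rewrite tens_lift_sum; last exact: slice_bilinear.
rewrite big_map big_enum /= (bigD1_ord j) //= mu1 scale1r big1 ?addr0 // => i _.
rewrite mu0 ?scale0r //; exists (fun k => (k == i)%:R).
rewrite (bigD1 i) //= eqxx scale1r big1 ?addr0 // => k /negPf->.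
by rewrite scale0r.
Qed.

End SliceDecomposition.

(** * Sweedler calculus *)

Lemma tens_assoc_bilinear (K : fieldType) (U V W : lmodType K) :
  bilinear_for *:%R *:%R (fun (t : tensor U V) (w : W) =>
    tens_lift (fun u v => u ⊗ (v ⊗ w)) t).
Proof.
split=> [w|t]; first apply: tens_lift_linear.
  by split=> [v k u u'|u k v v']; rewrite ?(tensDl, tensDr, tensZl, tensZr).
apply: (tens_lift_linear_param (h := fun w u v => u ⊗ (v ⊗ w))) => u v k w w'.
by rewrite ?(tensDl, tensDr, tensZl, tensZr).
Qed.

Section SweedlerCalculus.
Variables (K : fieldType) (A : hopfAlgType K) (U : lmodType K).
Implicit Types (x y : A) (g : A -> A -> U).

Lemma tens_lift_mul (t t' : tensor A A) g : bilinear_for *:%R *:%R g ->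
  tens_lift g (t * t') = tens_lift (fun a b =>
    tens_lift (fun c d => g (a * c) (b * d)) t') t.
Proof.
move=> bg; rewrite -[t * t']/(tens_mul t t') /tens_mul.
rewrite (linear_tens_lift _ _ (tens_lift_linear bg)); apply: eq_tens_lift => a b.
rewrite (linear_tens_lift _ _ (tens_lift_linear bg)); apply: eq_tens_lift => c d.
exact: tens_liftE.
Qed.

Lemma sw_mul x y g : bilinear_for *:%R *:%R g ->
  \sw_(a, b <- x * y) g a b =
  \sw_(a, b <- x) \sw_(c, d <- y) g (a * c) (b * d).
Proof. by move=> bg; rewrite rmorphM tens_lift_mul. Qed.

(** Coassociativity in the form used below: a trilinear f sees the iterated
coproduct only through x1 ⊗ x2 ⊗ x3, obtained by splitting either leg. *)
Lemma sw_coassoc x (f : A -> A -> A -> U) :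
    (forall b c, linear (fun a => f a b c)) ->
    (forall a c, linear (fun b => f a b c)) ->
    (forall a b, linear (fun c => f a b c)) ->
  \sw_(a, c <- x) \sw_(a1, a2 <- a) f a1 a2 c =
  \sw_(a, b <- x) \sw_(b1, b2 <- b) f a b1 b2.
Proof.
move=> l1 l2 l3.
have b23 a : bilinear_for *:%R *:%R (f a) by split.
pose F := tens_lift (fun a t => tens_lift (f a) t).
have bF : bilinear_for *:%R *:%R (fun a (t : tensor A A) => tens_lift (f a) t).
  by split=> [t|a]; [apply: tens_lift_linear_param|apply: tens_lift_linear].
have lF : linear F by exact: tens_lift_linear.
have := congr1 F (comulA x); rewrite /tens_map.
have lassoc : linear (@tens_assoc K A A A).
  exact: tens_lift_linear (tens_assoc_bilinear A A A).
rewrite (linear_tens_lift _ _ lassoc) !(linear_tens_lift _ _ lF) => E.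
transitivity (\sw_(a, c <- x) F (tens_assoc (comul a ⊗ idfun c))).
  apply: eq_tens_lift => a c; rewrite /tens_assoc tens_liftE; last first.
    exact: tens_assoc_bilinear.
  rewrite (linear_tens_lift _ _ lF); apply: eq_tens_lift => a1 a2.
  by rewrite /F !tens_liftE.
by rewrite E; apply: eq_tens_lift => a b; apply: (tens_liftE bF).
Qed.

Lemma sw_counitl x (h : A -> U) : linear h ->
  \sw_(a, b <- x) (counit a *: h b) = h x.
Proof.
move=> lh; rewrite -[in RHS](comul_counitl x) (linear_tens_lift _ _ lh).
by apply: eq_tens_lift => a b; rewrite (linear_funZ _ _ lh).
Qed.

Lemma sw_counitr x (h : A -> U) : linear h ->
  \sw_(a, b <- x) (counit b *: h a) = h x.
Proof.
move=> lh; rewrite -[in RHS](comul_counitr x) (linear_tens_lift _ _ lh).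
by apply: eq_tens_lift => a b; rewrite (linear_funZ _ _ lh).
Qed.

Lemma tens_mul_lift_bilinear (t : tensor A A) g : bilinear_for *:%R *:%R g ->
  bilinear_for *:%R *:%R (fun a b =>
    tens_lift (fun c d => g (a * c) (b * d)) t).
Proof.
move=> [gl gr]; split=> [b|a].
  apply: (tens_lift_linear_param (h := fun a c d => g (a * c) (b * d))).
  by move=> c d k a a'; rewrite mulrDl -scalerAl gl.
apply: (tens_lift_linear_param (h := fun b c d => g (a * c) (b * d))).
by move=> c d k b b'; rewrite mulrDl -scalerAl gr.
Qed.

(** Membership in N^l, read as x1 ⊗ P x2 = x ⊗ P under the bilinear map g. *)
Lemma sw_Nl (P x : A) g : Nl P x -> bilinear_for *:%R *:%R g ->
  \sw_(a, b <- x) g a (P * b) = g x P.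
Proof.
move=> Nx bg; have := congr1 (tens_lift g) Nx.
rewrite tens_lift_mul // !tens_liftE //; last exact: tens_mul_lift_bilinear.
by move=> <-; apply: eq_tens_lift => a b; rewrite mul1r.
Qed.

Lemma sw_Nr (P x : A) g : Nr P x -> bilinear_for *:%R *:%R g ->
  \sw_(a, b <- x) g a (b * P) = g x P.
Proof.
move=> Nx bg; have := congr1 (tens_lift g) Nx.
rewrite tens_lift_mul // tens_liftE // => <-; apply: eq_tens_lift => a b.
rewrite tens_liftE ?mulr1 //; case: bg => gl gr.
by split=> [d k c c'|c k d d'] /=; rewrite mulrDr -scalerAr (gl, gr).
Qed.

End SweedlerCalculus.
(** * Moving a factor across the coproduct of P *)

Section AntipodeIdentities.
Variables (K : fieldType) (A : hopfAlgType K).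
Implicit Types (P p x y : A).

Lemma mulr_lin x : linear (fun y => x * y).
Proof. by move=> k y z; rewrite mulrDr -scalerAr. Qed.

Lemma mulr_linr x : linear (fun y => y * x).
Proof. by move=> k y z; rewrite mulrDl -scalerAl. Qed.

(** The only consequence of antimultiplicativity of S that is needed, with a direct
proof: x1 S(p x2) = S(p1) p2 x1 S(p3 x2), in which p2 x1 and p3 x2 are the
components of the coproduct of a single product. *)
Lemma antipode_twist p x :
  \sw_(a, b <- x) (a * antipode (p * b)) = counit x *: antipode p.
Proof.
pose h q := \sw_(a, b <- x) (a * antipode (q * b)).
have lh : linear h.
  apply: (tens_lift_linear_param (h := fun q a b => a * antipode (q * b))).
  by move=> a b k q q'; rewrite mulrDl -scalerAl linearP mulrDr -scalerAr.
have hS q : \sw_(c, d <- q) (c * h d) = (counit (q * x))%:A.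
  rewrite -antipoder sw_mul; last first.
    by split=> [b|a]; [exact: mulr_linr|move=> k b b'];
      rewrite linearP mulrDr -scalerAr.
  apply: eq_tens_lift => c d; rewrite (linear_tens_lift _ _ (@mulr_lin c)).
  by apply: eq_tens_lift => a b; rewrite mulrA.
transitivity (\sw_(a, b <- p) \sw_(a1, a2 <- a) (antipode a1 * (a2 * h b))).
  rewrite -[LHS](sw_counitl p lh); apply: eq_tens_lift => a b.
  rewrite -mulr_algl -antipodel (linear_tens_lift _ _ (@mulr_linr (h b))).
  by apply: eq_tens_lift => a1 a2; rewrite mulrA.
rewrite (sw_coassoc _ (f := fun a b c => antipode a * (b * h c))).
- transitivity (\sw_(a, b <- p) counit b *: (counit x *: antipode a)).
    apply: eq_tens_lift => a b.
    rewrite -(linear_tens_lift _ _ (@mulr_lin (antipode a))) hS.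
    by rewrite mulr_algr rmorphM scalerA.
  apply: (sw_counitr _ (h := fun a => counit x *: antipode a)).
  by move=> k a a'; rewrite linearP scalerDr !scalerA mulrC.
- by move=> b c k a a'; rewrite linearP mulrDl -scalerAl.
- by move=> a c k b b'; rewrite mulrDl -scalerAl mulrDr -scalerAr.
- by move=> a b k c c'; rewrite lh !mulrDr -!scalerAr.
Qed.

(** In Sweedler notation, both sides are x1 S(P1 x2) ⊗ P2 x3: the right one because
x1 ⊗ P x2 = x ⊗ P, the left one by [antipode_twist]. *)
Lemma Nl_twist P x : Nl P x ->
  \sw_(p, q <- P) antipode p ⊗ (q * x) = \sw_(p, q <- P) (x * antipode p) ⊗ q.
Proof.
move=> Nx; pose f a c d : tensor A A := (a * antipode c) ⊗ d.
have fl1 c d : linear (fun a => f a c d).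
  by move=> k a a'; rewrite /f mulrDl -scalerAl tensDl tensZl.
have fl2 a d : linear (fun c => f a c d).
  by move=> k c c'; rewrite /f linearP mulrDr -scalerAr tensDl tensZl.
have fl3 a c : linear (f a c).
  by move=> k d d'; rewrite /f tensDr tensZr.
have bf a : bilinear_for *:%R *:%R (f a) by split.
have bg : bilinear_for *:%R *:%R (fun a b => \sw_(c, d <- b) f a c d).
  split=> [b|a]; first exact: tens_lift_linear_param.
  by move=> k b b' /=; rewrite linearP tens_lift_linear.
rewrite -[RHS](sw_Nl Nx bg).
transitivity (\sw_(a, b <- x) \sw_(b1, b2 <- b) \sw_(p, q <- P)
    f a (p * b1) (q * b2)); last first.
  by apply: eq_tens_lift => a b; rewrite sw_mul // exchange_tens_lift.
rewrite -(sw_coassoc _ (f := fun a b c => \sw_(p, q <- P) f a (p * b) (q * c))).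
- transitivity (\sw_(p, q <- P) \sw_(a, b <- x)
      (counit a *: (antipode p ⊗ (q * b)))).
    apply: eq_tens_lift => p q.
    rewrite (sw_counitl _ (h := fun y => antipode p ⊗ (q * y))) //.
    by move=> k b b'; rewrite mulrDr -scalerAr tensDr tensZr.
  rewrite exchange_tens_lift; apply: eq_tens_lift => a b.
  rewrite exchange_tens_lift; apply: eq_tens_lift => p q.
  rewrite -tensZl -antipode_twist.
  rewrite (linear_tens_lift _ _ (h := fun y => y ⊗ (q * b))) //.
  by move=> k y y'; rewrite tensDl tensZl.
- by move=> b c; apply: tens_lift_linear_param.
- move=> a c; apply: (tens_lift_linear_param
    (h := fun b p q => f a (p * b) (q * c))) => p q k b b'.
  by rewrite mulrDr -scalerAr fl2.
- move=> a b; apply: (tens_lift_linear_param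
    (h := fun c p q => f a (p * b) (q * c))) => p q k c c'.
  by rewrite mulrDr -scalerAr fl3.
Qed.

(** In Sweedler notation, both sides are S(x1) x2 P1 ⊗ x3 P2: the right one because
x1 ⊗ x2 P = x ⊗ P, the left one by the antipode axiom. *)
Lemma Nr_twist P x : Nr P x ->
  \sw_(p, q <- P) p ⊗ (x * q) = \sw_(p, q <- P) (antipode x * p) ⊗ q.
Proof.
move=> Nx; pose f a c d : tensor A A := (antipode a * c) ⊗ d.
have fl1 c d : linear (fun a => f a c d).
  by move=> k a a'; rewrite /f linearP mulrDl -scalerAl tensDl tensZl.
have fl2 a d : linear (fun c => f a c d).
  by move=> k c c'; rewrite /f mulrDr -scalerAr tensDl tensZl.
have fl3 a c : linear (f a c).
  by move=> k d d'; rewrite /f tensDr tensZr.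
have bf a : bilinear_for *:%R *:%R (f a) by split.
have bg : bilinear_for *:%R *:%R (fun a b => \sw_(c, d <- b) f a c d).
  split=> [b|a]; first exact: tens_lift_linear_param.
  by move=> k b b' /=; rewrite linearP tens_lift_linear.
rewrite -[RHS](sw_Nr Nx bg).
transitivity (\sw_(a, b <- x) \sw_(b1, b2 <- b) \sw_(p, q <- P)
    f a (b1 * p) (b2 * q)); last first.
  by apply: eq_tens_lift => a b; rewrite sw_mul.
rewrite -(sw_coassoc _ (f := fun a b c => \sw_(p, q <- P) f a (b * p) (c * q))).
- transitivity (\sw_(p, q <- P) \sw_(a, b <- x) (counit a *: (p ⊗ (b * q)))).
    apply: eq_tens_lift => p q.
    rewrite (sw_counitl _ (h := fun y => p ⊗ (y * q))) //.
    by move=> k b b'; rewrite mulrDl -scalerAl tensDr tensZr.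
  rewrite exchange_tens_lift; apply: eq_tens_lift => a b.
  rewrite exchange_tens_lift; apply: eq_tens_lift => p q.
  rewrite -tensZl -mulr_algl -antipodel.
  rewrite (linear_tens_lift _ _ (h := fun y => (y * p) ⊗ (b * q))).
    by apply: eq_tens_lift => a1 a2; rewrite /f mulrA.
  by move=> k y y'; rewrite mulrDl -scalerAl tensDl tensZl.
- by move=> b c; apply: tens_lift_linear_param.
- move=> a c; apply: (tens_lift_linear_param
    (h := fun b p q => f a (b * p) (c * q))) => p q k b b'.
  by rewrite mulrDl -scalerAl fl2.
- move=> a b; apply: (tens_lift_linear_param
    (h := fun c p q => f a (b * p) (c * q))) => p q k c c'.
  by rewrite mulrDl -scalerAl fl3.
Qed.

End AntipodeIdentities.
(** * The coideal generated by P *)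

Section CoidealOf.
Variables (K : fieldType) (A : hopfAlgType K).
Implicit Types (P x y : A) (mu : {scalar A}) (V W : set A).

Lemma subspace_sum V (I : eqType) (s : seq I) (F : I -> A) :
  is_subspace V -> (forall i, i \in s -> V (F i)) -> V (\sum_(i <- s) F i).
Proof.
move=> [V0 VP]; elim: s => [|i s IHs] sV; first by rewrite big_nil.
rewrite big_cons -[F i]scale1r; apply: VP; first exact/sV/mem_head.
by apply: IHs => j js; apply: sV; rewrite inE js orbT.
Qed.

Lemma subspaceZ V k x : is_subspace V -> V x -> V (k *: x).
Proof. by move=> [V0 VP] Vx; rewrite -[_ *: _]addr0; apply: VP. Qed.

Lemma slice_linear mu : linear (slice mu : tensor A A -> A).
Proof. exact/tens_lift_linear/slice_bilinear. Qed.

Lemma coideal_of_lift P (f : A -> K) : scalar f ->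
  coideal_of P (\sw_(a, b <- P) (f a *: b)).
Proof.
move=> lf; pose m := GRing.isLinear.Build K A K *%R f lf.
by pose mu : {scalar A} := HB.pack f m; exists mu.
Qed.

Lemma coideal_of_subspace P : is_subspace (coideal_of P).
Proof.
split=> [|k _ _ [mu ->] [nu ->]].
  have l0 : scalar (fun _ : A => 0 : K) by move=> k x y; rewrite mulr0 addr0.
  have := coideal_of_lift P l0; congr (coideal_of P _).
  by apply: big1 => p _; rewrite scale0r.
have lf : scalar (fun a => k * mu a + nu a).
  move=> c x y; rewrite !linearP /= !mulrDr addrACA; congr (_ + _ + _).
  by rewrite mulrCA.
have := coideal_of_lift P lf; congr (coideal_of P _).
rewrite /slice /tens_lift scaler_sumr -big_split; apply: eq_bigr => p _ /=.
by rewrite scalerDl scalerA.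
Qed.

Lemma comul_decomposition P : tens_right (coideal_of P) (comul P).
Proof. by have [s sV PE] := slice_decomposition (comul P); exists s. Qed.

Lemma slice_comul_bilinear mu :
  bilinear_for *:%R *:%R (fun a b : A => slice mu (comul a) ⊗ b).
Proof.
split=> [b|a] k x y /=; last by rewrite tensDr tensZr.
by rewrite linearP slice_linear tensDl tensZl.
Qed.

(** By coassociativity, slicing Δ(P) and then comultiplying the second leg amounts to
slicing the coproduct of the first leg. Every term on the right keeps the second
leg of Δ(P), which is why V is a left coideal and inherits from P the equations
defining N^l and N^r. *)
Lemma comul_slice P mu :
  comul (slice mu (comul P)) = \sw_(a, b <- P) slice mu (comul a) ⊗ b.
Proof.
have comul_lin : linear (comul : A -> tensor A A) by exact: linearP.
rewrite /slice (linear_tens_lift _ _ comul_lin).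
transitivity (\sw_(a, b <- P) \sw_(b1, b2 <- b) (mu a *: b1) ⊗ b2).
  apply: eq_tens_lift => a b.
  rewrite linearZ /= -[in LHS](tens_lift_tens (comul b)).
  rewrite (linear_tens_lift _ _ (h := *:%R (mu a))); last first.
    by move=> k u v; rewrite scalerDr !scalerA mulrC.
  by apply: eq_tens_lift => b1 b2; rewrite tensZl.
rewrite -(sw_coassoc _ (f := fun a b c => (mu a *: b) ⊗ c)).
- apply: eq_tens_lift => a b.
  rewrite (linear_tens_lift _ _ (h := fun y => y ⊗ b)) //.
  by move=> k u v; rewrite tensDl tensZl.
- by move=> b c k a a'; rewrite linearP scalerDl -scalerA tensDl tensZl.
- by move=> a c k b b'; rewrite scalerDr scalerA mulrC -scalerA tensDl tensZl.
- by move=> a b k c c'; rewrite tensDr tensZr.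
Qed.

(** P itself is the slice along the counit. A left coideal W through P has
Δ(P) in A ⊗ W, so all slices of Δ(P) are in W. *)
Lemma coideal_of_smallest P : is_smallest_left_coideal P (coideal_of P).
Proof.
split=> [||W [subW coW] WP _ [mu ->]].
- split=> [|_ [mu ->]]; first exact: coideal_of_subspace.
  have [s sV PE] := comul_decomposition P.
  exists [seq (slice mu (comul p.1), p.2) | p <- s].
    by move=> _ /mapP[p ps ->] /=; exact: (sV p).
  rewrite comul_slice PE tens_lift_sum ?big_map //.
  exact: slice_comul_bilinear.
- rewrite -[X in _ X](comul_counitl P); apply: coideal_of_lift.
  exact: linearP.
- have [s sW ->] := coW _ WP.
  rewrite /slice tens_lift_sum; last exact: slice_bilinear.
  by apply: subspace_sum => // p ps; exact: (subspaceZ _ subW (sW p ps)).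
Qed.

Lemma sub_Nl P : Nl P P -> coideal_of P `<=` Nl P.
Proof.
move=> NP _ [mu ->]; rewrite /Nl /= comul_slice.
have lM : linear (fun t : tensor A A => (1 ⊗ P) * t).
  by move=> k t t'; rewrite mulrDr -tens_scalerAr.
rewrite (linear_tens_lift _ _ lM) -(sw_Nl NP (slice_comul_bilinear mu)).
by apply: eq_tens_lift => a b; rewrite tensM mul1r.
Qed.

Lemma sub_Nr P : Nr P P -> coideal_of P `<=` Nr P.
Proof.
move=> NP _ [mu ->]; rewrite /Nr /= comul_slice.
have lM : linear (fun t : tensor A A => t * (1 ⊗ P)).
  by move=> k t t'; rewrite mulrDl -tens_scalerAl.
rewrite (linear_tens_lift _ _ lM) -(sw_Nr NP (slice_comul_bilinear mu)).
by apply: eq_tens_lift => a b; rewrite tensM mulr1.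
Qed.

(** With T the inverse of S, the slice along mu times x is the slice along
mu(T(x S(-))). *)
Lemma coideal_of_mulr P x y : bijective (antipode : A -> A) ->
  Nl P x -> coideal_of P y -> coideal_of P (y * x).
Proof.
move=> [T ST TS] Nx [mu ->].
have lT : linear T := can2_linear ST TS.
have lmuT k u v : mu (T (k *: u + v)) = k * mu (T u) + mu (T v).
  by rewrite lT linearP.
have lf : scalar (fun a => mu (T (x * antipode a))).
  by move=> k a b; rewrite linearP mulrDr -scalerAr lmuT.
have := coideal_of_lift P lf; congr (coideal_of P _).
pose G (t : tensor A A) := tens_lift (fun a b => mu (T a) *: b) t.
have bG : bilinear_for *:%R *:%R (fun a b : A => mu (T a) *: b).
  split=> [b|a] k u v /=; last by rewrite scalerDr !scalerA mulrC.
  by rewrite lmuT scalerDl scalerA.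
have lG : linear G by apply: tens_lift_linear.
have := congr1 G (Nl_twist Nx); rewrite !(linear_tens_lift _ _ lG) => E.
transitivity (\sw_(p, q <- P) G ((x * antipode p) ⊗ q)).
  by apply: eq_tens_lift => a b; rewrite /G tens_liftE.
rewrite -E /slice (linear_tens_lift _ _ (@mulr_linr _ _ x)).
by apply: eq_tens_lift => a b; rewrite /G tens_liftE // ST scalerAl.
Qed.

(** x times the slice along mu is the slice along mu(S(x) -). *)
Lemma coideal_of_mull P x y :
  Nr P x -> coideal_of P y -> coideal_of P (x * y).
Proof.
move=> Nx [mu ->].
have lf : scalar (fun a => mu (antipode x * a)).
  by move=> k a b; rewrite mulrDr -scalerAr linearP.
have := coideal_of_lift P lf; congr (coideal_of P _).
have := congr1 (slice mu) (Nr_twist Nx).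
have sliceE a b : slice mu (a ⊗ b) = mu a *: b.
  exact/tens_liftE/slice_bilinear.
rewrite !(linear_tens_lift _ _ (@slice_linear mu)) => E.
transitivity (\sw_(p, q <- P) slice mu ((antipode x * p) ⊗ q)).
  by apply: eq_tens_lift => a b; rewrite sliceE.
rewrite -E [in RHS]/slice (linear_tens_lift _ _ (@mulr_lin _ _ x)).
by apply: eq_tens_lift => a b; rewrite sliceE -scalerAr.
Qed.

(** Expanding Δ(P) = Δ(P)Δ(P) over a decomposition of Δ(P) in A ⊗ V writes the slice
along mu as the sum of the products mu(c_i c_j) v_i v_j. *)
Lemma coideal_of_idem P : P * P = P ->
  coideal_of P `<=` prod_span (coideal_of P) (coideal_of P).
Proof.
move=> PP _ [mu ->]; have [s sV PE] := comul_decomposition P.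
exists [seq (mu (p.1 * q.1) *: p.2, q.2) | p <- s, q <- s].
  move=> _ /allpairsP[[p q] /= [ps qs ->]] /=; split; last exact: sV.
  by apply: subspaceZ; [exact: coideal_of_subspace|exact: sV].
rewrite big_allpairs_dep -{1}PP /slice sw_mul; last first.
  exact: slice_bilinear.
rewrite PE tens_lift_sum; last first.
  exact: (tens_mul_lift_bilinear _ (slice_bilinear A mu)).
apply: eq_bigr => p _; rewrite tens_lift_sum; last first.
  have [sl sr] := slice_bilinear A mu.
  by split=> [b|a] k u v /=; rewrite mulrDr -scalerAr ?(sl, sr).
by apply: eq_bigr => q _; rewrite scalerAl.
Qed.

Lemma ideal_eq_unital (N V : set A) : V `<=` N -> N 1 ->
  (V 1 -> N `<=` V) -> V = N <-> V 1.
Proof.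
move=> VN N1 NV; split=> [->//|V1]; apply/seteqP; split=> //; exact: NV.
Qed.

End CoidealOf.

Theorem proposition3p13 (K : fieldType) (A : hopfAlgType K)
    (S_inv : bijective (antipode : A -> A)) (P : A)
    (hP : right_group_like_projection P) :
  [/\ is_smallest_left_coideal P (coideal_of P),
      is_right_ideal (Nl P) (coideal_of P),
      is_left_ideal (Nr P) (coideal_of P),
      is_ideal (Nlr P) (coideal_of P)
    & prod_span (coideal_of P) (coideal_of P) = coideal_of P] /\
  [/\ coideal_of P = Nlr P <-> coideal_of P 1,
      coideal_of P = Nl P <-> coideal_of P 1,
      coideal_of P = Nr P <-> coideal_of P 1
    & coideal_of P 1 -> Nl P = Nlr P /\ Nlr P = Nr P].
Proof.
have [_ PP NrP /esym NlP] := hP.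
have Vsub := coideal_of_subspace P.
have VNl : coideal_of P `<=` Nl P := sub_Nl NlP.
have VNr : coideal_of P `<=` Nr P := sub_Nr NrP.
have VNlr : coideal_of P `<=` Nlr P.
  by move=> x Vx; split; [exact: VNl|exact: VNr].
have mulVr x n : coideal_of P x -> Nl P n -> coideal_of P (x * n).
  by move=> Vx Nn; apply: coideal_of_mulr.
have mulVl n x : Nr P n -> coideal_of P x -> coideal_of P (n * x).
  exact: coideal_of_mull.
have [_ Nl1 _] := Nl_unital_subalgebra P.
have [_ Nr1 _] := Nr_unital_subalgebra P.
have eqNl : coideal_of P = Nl P <-> coideal_of P 1.
  by apply: ideal_eq_unital => // V1 n Nn; rewrite -[n]mul1r; apply: mulVr.
have eqNr : coideal_of P = Nr P <-> coideal_of P 1.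
  by apply: ideal_eq_unital => // V1 n Nn; rewrite -[n]mulr1; apply: mulVl.
have eqNlr : coideal_of P = Nlr P <-> coideal_of P 1.
  by apply: ideal_eq_unital => // V1 n [Nn _]; rewrite -[n]mul1r; apply: mulVr.
split; split=> //; first exact: coideal_of_smallest.
- split; split=> //.
    by move=> n x [_ Nn]; apply: mulVl.
  by move=> x n Vx [Nn _]; apply: mulVr.
- apply/seteqP; split; last exact: coideal_of_idem.
  move=> _ [s sV ->]; apply: subspace_sum => // p /sV[Vp1 Vp2].
  exact/mulVr/VNl.
- by move=> V1; rewrite -(eqNl.2 V1) -(eqNlr.2 V1) -(eqNr.2 V1).
Qed.
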